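(* For all positive integers $k$, $r$ and $c$, there is an integer $N$ such that every set $A$ of $N$ lines in $\mathbb{R}^2$ in which no $r+1$ lines pass through a common point contains pairwise disjoint subsets $A_1,\dots,A_k$ with $|A_i|\ge c$ for all $i$, such that every transversal of $CH(A_1),\dots,CH(A_k)$ is in convex position.
   Context: For a finite set $A$ of lines in $\mathbb{R}^2$, $V(A)$ is the set of intersection points of pairs of lines of $A$ and $CH(A)$ is the convex hull of $V(A)$. A transversal of sets $X_1,\dots,X_k$ is a $k$-tuple $(x_1,\dots,x_k)$ with $x_i\in X_i$. A finite point set is in convex position if each of its points is a vertex of its convex hull. *)

(* Defs.v *)
From Stdlib Require Import Reals List.
Open Scope R_scope.

Definition point : Type := (R * R)%type.

Definition line : Type := (R * R * R)%type.

Definition on_line (l : line) (p : point) : Prop :=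
  let '(a, b, c) := l in a * fst p + b * snd p = c.

Definition nondeg (l : line) : Prop :=
  let '(a, b, _) := l in a <> 0 \/ b <> 0.

Definition same_line (l1 l2 : line) : Prop :=
  forall p, on_line l1 p <-> on_line l2 p.

Definition V (A : nat -> line) (S : list nat) (p : point) : Prop :=
  exists i j, In i S /\ In j S /\ i <> j /\ on_line (A i) p /\ on_line (A j) p.

Definition padd (p q : point) : point := (fst p + fst q, snd p + snd q).
Definition pscale (t : R) (p : point) : point := (t * fst p, t * snd p).

Definition conv (P : point -> Prop) (p : point) : Prop :=
  exists l : list (R * point),
    (forall w q, In (w, q) l -> 0 <= w /\ P q) /\
    fold_right (fun wq s => fst wq + s) 0 l = 1 /\
    p = fold_right (fun wq s => padd (pscale (fst wq) (snd wq)) s) (0, 0) l.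

Definition CH (A : nat -> line) (S : list nat) : point -> Prop :=
  conv (V A S).

Definition vertex (C : point -> Prop) (p : point) : Prop :=
  C p /\
  ~ (exists q s t, C q /\ C s /\ q <> s /\ 0 < t < 1 /\
       p = padd (pscale t q) (pscale (1 - t) s)).

Definition convex_position (P : point -> Prop) : Prop :=
  forall p, P p -> vertex (conv P) p.

Definition no_r1_concurrent (N r : nat) (A : nat -> line) : Prop :=
  forall (p : point) (S : list nat),
    NoDup S -> (forall i, In i S -> (i < N)%nat /\ on_line (A i) p) ->
    (length S <= r)%nat.

(* Main.v *)
(** If k(c+3) of the lines are parallel, put them into the groups: the hulls are empty.
    Otherwise many lines have distinct slopes; dualise y = m x + b to the point (m, b). By
    Erdos-Szekeres some of the dual points form a long weakly convex or concave chain, which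
    thins out to a strict one because no r+1 of the lines are concurrent. Reflecting through
    the origin, assume the chain concave: then the lines, in order of slope, all appear on
    their upper envelope. Cut the chain into blocks of c+3 consecutive lines. The line
    through the first and the last envelope vertex of a block has the hull of that block
    weakly below it and the hulls of all other blocks strictly above, earlier blocks to the
    left and later ones to the right; so every transversal is a strictly convex chain. *)

Require Import Defs.
From Stdlib Require Import Reals List.
From Stdlib Require Import Lra Lia Classical.
Open Scope R_scope.

(** * Splitting lists and the pigeonhole principle *)

Lemma list_partition {T : Type} (P : T -> Prop) (l : list T) :
  NoDup l ->
  exists l1 l2, NoDup l1 /\ NoDup l2 /\
    (forall x, In x l1 -> In x l /\ P x) /\
    (forall x, In x l2 -> In x l /\ ~ P x) /\
    (length l1 + length l2 = length l)%nat.
Proof.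
  induction l as [|x l IH]; intros Hl.
  - exists nil, nil; simpl; repeat split; try constructor; contradiction.
  - inversion Hl as [|? ? Hx Hl']; subst.
    destruct (IH Hl') as (l1 & l2 & N1 & N2 & H1 & H2 & Hlen).
    destruct (classic (P x)) as [HP|HP].
    + exists (x :: l1), l2; repeat split; auto.
      * constructor; auto; intros Hin; apply Hx, (H1 x Hin).
      * destruct H as [->|H]; [left; auto | right; apply (H1 _ H)].
      * destruct H as [->|H]; [auto | apply (H1 _ H)].
      * right; apply (H2 _ H).
      * apply (H2 _ H).
      * simpl; lia.
    + exists l1, (x :: l2); repeat split; auto.
      * constructor; auto; intros Hin; apply Hx, (H2 x Hin).
      * right; apply (H1 _ H).
      * apply (H1 _ H).
      * destruct H as [->|H]; [left; auto | right; apply (H2 _ H)].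
      * destruct H as [->|H]; [auto | apply (H2 _ H)].
      * simpl; lia.
Qed.

(** If the fibre of the head has fewer than [a] elements, dropping it leaves enough for [b - 1]
    other values, and the head stays as its representative. *)
Lemma pigeonhole_fibres {T X : Type} (f : T -> X) (a b : nat) (l : list T) :
  NoDup l -> (S a * b <= length l)%nat ->
  (exists l' z, NoDup l' /\ (forall x, In x l' -> In x l /\ f x = z) /\
     (a <= length l')%nat) \/
  (exists l', NoDup l' /\ (forall x, In x l' -> In x l) /\ length l' = b /\
     (forall x y, In x l' -> In y l' -> x <> y -> f x <> f y)).
Proof.
  revert l; induction b as [|b IH]; intros l Hl Hlen.
  - right; exists nil; repeat split; try constructor; simpl; tauto.
  - destruct l as [|x l]; [simpl in Hlen; lia|].
    destruct (list_partition (fun y => f y = f x) (x :: l) Hl)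
      as (l1 & l2 & N1 & N2 & H1 & H2 & Hsum).
    destruct (Nat.le_gt_cases a (length l1)) as [Ha|Ha].
    + left; exists l1, (f x); auto.
    + destruct (IH l2 N2) as [(l' & z & K1 & K2 & K3)|(l' & K1 & K2 & K3 & K4)].
      * lia.
      * left; exists l', z; repeat split; auto; intros; apply K2 in H; [|tauto].
        apply H2, H.
      * right; exists (x :: l'); repeat split.
        -- constructor; auto; intros Hin; apply K2 in Hin; apply H2 in Hin; tauto.
        -- intros y [->|Hy]; [left; auto | apply H2, K2, Hy].
        -- simpl; lia.
        -- intros y z [->|Hy] [->|Hz] Hyz; try tauto.
           ++ intros E; apply K2, H2 in Hz; apply (proj2 Hz); auto.
           ++ intros E; apply K2, H2 in Hy; apply (proj2 Hy); auto.
           ++ auto.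
Qed.

(** * Erdos-Szekeres for an abstract relation on triples *)

(** [n] counts edges, so there are [n + 1] points. [Q] constrains consecutive triples only:
    lengthening a chain by one point costs a single instance of [Q]. *)
Definition chain {T : Type} (lt : T -> T -> Prop) (Q : T -> T -> T -> Prop)
    (l : list T) (n : nat) (s : nat -> T) : Prop :=
  (forall i, (i <= n)%nat -> In (s i) l) /\
  (forall i, (i < n)%nat -> lt (s i) (s (S i))) /\
  (forall i, (S i < n)%nat -> Q (s i) (s (S i)) (s (S (S i)))).

Lemma chain_incl {T} lt Q (l l' : list T) n s :
  (forall x, In x l -> In x l') -> chain lt Q l n s -> chain lt Q l' n s.
Proof. intros H (H1 & H2 & H3); repeat split; auto. Qed.

Lemma chain_snoc {T} lt Q (l : list T) n s z :
  chain lt Q l (S n) s -> In z l -> lt (s (S n)) z -> Q (s n) (s (S n)) z ->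
  exists s', chain lt Q l (S (S n)) s'.
Proof.
  intros (H1 & H2 & H3) Hz Hlt HQ.
  exists (fun i => if Nat.leb i (S n) then s i else z).
  repeat split; intros i Hi.
  - destruct (Nat.leb_spec i (S n)); auto.
  - destruct (Nat.leb_spec i (S n)); [|lia].
    destruct (Nat.leb_spec (S i) (S n)); [apply H2; lia|].
    replace i with (S n) by lia; auto.
  - destruct (Nat.leb_spec i (S n)); [|lia].
    destruct (Nat.leb_spec (S i) (S n)); [|lia].
    destruct (Nat.leb_spec (S (S i)) (S n)); [apply H3; lia|].
    replace i with n by lia; auto.
Qed.

Lemma chain_cons {T} lt Q (l : list T) n s z :
  chain lt Q l (S n) s -> In z l -> lt z (s 0%nat) -> Q z (s 0%nat) (s 1%nat) ->
  exists s', chain lt Q l (S (S n)) s'.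
Proof.
  intros (H1 & H2 & H3) Hz Hlt HQ.
  exists (fun i => match i with O => z | S j => s j end).
  repeat split; intros [|i] Hi; auto.
  - apply H1; lia.
  - apply H2; lia.
  - apply H3; lia.
Qed.

Lemma chain_single_edge {T} (lt : T -> T -> Prop) Q (l : list T) :
  NoDup l ->
  (forall x y, In x l -> In y l -> x <> y -> lt x y \/ lt y x) ->
  (2 <= length l)%nat -> exists s, chain lt Q l 1 s.
Proof.
  intros Hl Htot Hlen.
  destruct l as [|x [|y l]]; simpl in Hlen; try lia.
  assert (Hxy : x <> y).
  { inversion Hl as [|? ? Hx]; intros ->; apply Hx; left; auto. }
  assert (E : forall u v, In u (x :: y :: l) -> In v (x :: y :: l) -> lt u v ->
    exists s, chain lt Q (x :: y :: l) 1 s).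
  { intros u v Hu Hv Huv; exists (fun i => match i with O => u | _ => v end).
    repeat split; intros i Hi; [destruct i; auto | | lia].
    replace i with 0%nat by lia; auto. }
  destruct (Htot x y) as [H|H]; auto; [now left | now right; left | |];
    (eapply E; [| |exact H]; simpl; auto).
Qed.

(* The Erdos-Szekeres cups-caps recursion; it needs no property of the colouring [Q]. *)
Lemma cups_caps {T : Type} (a b : nat) :
  exists N, forall (lt : T -> T -> Prop) (Q : T -> T -> T -> Prop) (l : list T), NoDup l ->
    (forall x y, In x l -> In y l -> x <> y -> lt x y \/ lt y x) ->
    (N <= length l)%nat ->
    (exists s, chain lt Q l (S a) s) \/
    (exists s, chain lt (fun x y z => ~ Q x y z) l (S b) s).
Proof.
  revert b; induction a as [|a IHa]; intros b.
  { exists 2%nat; intros; left; apply chain_single_edge; auto. }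
  induction b as [|b [N2 IHb]].
  { exists 2%nat; intros; right; apply chain_single_edge; auto. }
  destruct (IHa (S b)) as [N1 HN1].
  exists (N1 + N2)%nat; intros lt Q l Hl Htot Hlen.
  (* [E] collects the right ends of the [Q]-chains with [S a] edges; [F] contains no such end, so a
     [Q]-chain of that length inside [F] is impossible. *)
  destruct (list_partition
    (fun x => exists s, chain lt Q l (S a) s /\ s (S a) = x) l Hl)
    as (E & F & NE & NF & HE & HF & Hsum).
  destruct (Nat.le_gt_cases N1 (length F)) as [Hc|Hc].
  - destruct (HN1 lt Q F NF) as [[s Hs]|[s Hs]]; auto.
    + intros x y Hx Hy; apply Htot; [apply HF, Hx | apply HF, Hy].
    + exfalso; apply (proj2 (HF (s (S a)) (proj1 Hs (S a) (le_n _)))).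
      exists s; split; auto; apply (chain_incl _ _ F); auto; apply HF.
    + right; exists s; apply (chain_incl _ _ F); auto; apply HF.
  - destruct (IHb lt Q E NE) as [[s Hs]|[s Hs]].
    + intros x y Hx Hy; apply Htot; [apply HE, Hx | apply HE, Hy].
    + lia.
    + left; exists s; apply (chain_incl _ _ E); auto; apply HE.
    (* A [Q]-chain [s'] ends where the other chain [s] starts; the triple around the common point
       lengthens one of the two, according to its colour. *)
    + destruct (proj2 (HE (s 0%nat) (proj1 Hs 0%nat (Nat.le_0_l _)))) as (s' & Hs' & E0).
      assert (HsL := chain_incl _ _ E l _ _ (fun x Hx => proj1 (HE x Hx)) Hs).
      destruct (classic (Q (s' a) (s 0%nat) (s 1%nat))) as [HQ|HQ].
      * left; apply (chain_snoc _ _ _ _ s' (s 1%nat)); auto.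
        -- apply HsL; lia.
        -- rewrite E0; apply HsL; lia.
        -- rewrite E0; auto.
      * right; apply (chain_cons _ _ _ _ s (s' a)); auto.
        -- apply Hs'; lia.
        -- rewrite <- E0; apply Hs'; lia.
Qed.

(** * Convex hulls and exposed vertices *)

Lemma conv_min (P C : point -> Prop) :
  (forall q s t, C q -> C s -> 0 <= t <= 1 ->
     C (padd (pscale t q) (pscale (1 - t) s))) ->
  (forall q, P q -> C q) -> forall p, conv P p -> C p.
Proof.
  intros Hconv Hsub p (l & Hl & Hw & ->).
  set (W := fold_right (fun wq s => fst wq + s) 0 l) in *.
  (* Induction on the list: the partial sum divided by its total weight stays in [C]. Total weight 0
     is kept apart, as it cannot be normalised. *)
  assert (H : (W = 0 /\
      fold_right (fun wq s => padd (pscale (fst wq) (snd wq)) s) (0, 0) l = (0, 0)) \/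
    (0 < W /\ C (pscale (/ W)
      (fold_right (fun wq s => padd (pscale (fst wq) (snd wq)) s) (0, 0) l)))).
  { subst W; clear Hw; induction l as [|[w q] l IH]; [left; auto|].
    destruct (Hl w q (or_introl eq_refl)) as [Hw Hq].
    specialize (IH (fun w' q' H => Hl w' q' (or_intror H))).
    simpl; set (W := fold_right _ 0 l) in *.
    set (Z := fold_right (fun wq s => padd (pscale (fst wq) (snd wq)) s) (0, 0) l) in *.
    destruct IH as [[HW HZ]|[HW HZ]].
    - rewrite HW, HZ; destruct (Req_dec w 0) as [->|Hw0].
      + left; unfold padd, pscale; simpl; split; [lra | f_equal; lra].
      + right; split; [lra|].
        replace (pscale _ _) with q; [apply Hsub, Hq|].
        destruct q; unfold padd, pscale; simpl; f_equal; field; lra.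
    - right; split; [lra|].
      replace (pscale _ _) with
        (padd (pscale (w / (w + W)) q) (pscale (1 - w / (w + W)) (pscale (/ W) Z))).
      + apply Hconv; auto. split.
        * apply Rmult_le_pos; [lra | apply Rlt_le, Rinv_0_lt_compat; lra].
        * apply (Rmult_le_reg_r (w + W)); [lra|].
          unfold Rdiv; rewrite Rmult_assoc, Rinv_l; lra.
      + destruct q, Z; unfold padd, pscale; simpl; f_equal; field; lra. }
  destruct H as [[H _]|[_ H]]; [lra|].
  rewrite Hw in H.
  match type of H with C ?a => match goal with |- C ?b => replace b with a; auto end end.
  destruct (fold_right (fun wq s => padd (pscale (fst wq) (snd wq)) s) (0, 0) l);
    unfold pscale; simpl; f_equal; field.
Qed.

Lemma conv_le (P : point -> Prop) (u v w : R) :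
  (forall q, P q -> u * fst q + v * snd q <= w) ->
  forall p, conv P p -> u * fst p + v * snd p <= w.
Proof.
  apply (conv_min P (fun p => u * fst p + v * snd p <= w)).
  intros q s t Hq Hs Ht; simpl.
  assert (0 <= t * (w - (u * fst q + v * snd q))) by (apply Rmult_le_pos; lra).
  assert (0 <= (1 - t) * (w - (u * fst s + v * snd s))) by (apply Rmult_le_pos; lra).
  lra.
Qed.

Lemma combination_pos (t x y : R) :
  0 <= t <= 1 -> 0 < x -> 0 < y -> 0 < t * x + (1 - t) * y.
Proof.
  intros Ht Hx Hy.
  destruct (Req_dec t 0) as [->|H0]; [lra|].
  assert (0 < t * x) by (apply Rmult_lt_0_compat; lra).
  assert (0 <= (1 - t) * y) by (apply Rmult_le_pos; lra).
  lra.
Qed.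

Lemma conv_lt (P : point -> Prop) (u v w : R) :
  (forall q, P q -> u * fst q + v * snd q < w) ->
  forall p, conv P p -> u * fst p + v * snd p < w.
Proof.
  apply (conv_min P (fun p => u * fst p + v * snd p < w)).
  intros q s t Hq Hs Ht; simpl.
  assert (H := combination_pos t (w - (u * fst q + v * snd q))
    (w - (u * fst s + v * snd s)) Ht).
  lra.
Qed.

Lemma conv_empty (P : point -> Prop) :
  (forall q, ~ P q) -> forall p, ~ conv P p.
Proof. intros H p; exact (conv_min P (fun _ => False) (fun _ _ _ h _ _ => h) H p). Qed.

(** The point [p] together with the open half-plane where the functional exceeds its value at [p] is
    convex, so it contains the hull; a proper convex combination equal to [p] must then have both
    ends at [p]. *)
Lemma exposed_vertex (P : point -> Prop) (u v : R) (p : point) :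
  P p ->
  (forall q, P q -> q = p \/ u * fst p + v * snd p < u * fst q + v * snd q) ->
  vertex (conv P) p.
Proof.
  intros Hp Hmin.
  set (g := fun q : point => u * fst q + v * snd q) in *.
  assert (Hg : forall q s t, g (padd (pscale t q) (pscale (1 - t) s)) - g p
     = t * (g q - g p) + (1 - t) * (g s - g p)).
  { intros; unfold g; simpl; ring. }
  assert (HC : forall q, conv P q -> q = p \/ g p < g q).
  { apply conv_min; [|exact Hmin].
    intros q s t Hq Hs Ht. specialize (Hg q s t).
    destruct Hq as [->|Hq], Hs as [->|Hs].
    - left; destruct p; unfold padd, pscale; simpl; f_equal; ring.
    - destruct (Req_dec t 1) as [->|Ht1].
      + left; destruct p; unfold padd, pscale; simpl; f_equal; ring.
      + right. assert (0 < (1 - t) * (g s - g p)) by (apply Rmult_lt_0_compat; lra).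
        lra.
    - destruct (Req_dec t 0) as [->|Ht0].
      + left; destruct p; unfold padd, pscale; simpl; f_equal; ring.
      + right. assert (0 < t * (g q - g p)) by (apply Rmult_lt_0_compat; lra).
        lra.
    - right. assert (H := combination_pos t (g q - g p) (g s - g p) Ht). lra. }
  split.
  - exists ((1, p) :: nil); simpl; repeat split.
    + destruct H as [H|[]]; inversion H; lra.
    + destruct H as [H|[]]; inversion H; subst; auto.
    + lra.
    + destruct p; unfold padd, pscale; simpl; f_equal; ring.
  - intros (q & s & t & Hq & Hs & Hne & Ht & E).
    specialize (Hg q s t); rewrite <- E in Hg.
    destruct (HC q Hq) as [Eq|Hq'], (HC s Hs) as [Es|Hs'].
    + congruence.
    + rewrite Eq in Hg.
      assert (0 < (1 - t) * (g s - g p)) by (apply Rmult_lt_0_compat; lra). lra.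
    + rewrite Es in Hg.
      assert (0 < t * (g q - g p)) by (apply Rmult_lt_0_compat; lra). lra.
    + assert (H := combination_pos t (g q - g p) (g s - g p)). lra.
Qed.

(** * Convex chains of points *)

(** Twice the signed area of the triangle [p q s], positive when it is counterclockwise. *)
Definition orient (p q s : point) : R :=
  (fst q - fst p) * (snd s - snd p) - (snd q - snd p) * (fst s - fst p).

(* [eps] is the sign of the reflection through the origin that makes the chain run from left
   to right. *)
Lemma convex_chain_convex_position (k : nat) (eps : R) (x : nat -> point) :
  (forall i j, (i < j < k)%nat -> eps * fst (x i) < eps * fst (x j)) ->
  (forall i j l, (i < j)%nat -> (j < l < k)%nat -> 0 < orient (x i) (x j) (x l)) ->
  convex_position (fun p => exists i, (i < k)%nat /\ p = x i).
Proof.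
  intros Hx Ho p (j & Hj & ->).
  assert (E : forall u v,
    (forall i, (i < k)%nat -> i <> j ->
       u * fst (x j) + v * snd (x j) < u * fst (x i) + v * snd (x i)) ->
    vertex (conv (fun p => exists i, (i < k)%nat /\ p = x i)) (x j)).
  { intros u v H; apply (exposed_vertex _ u v); [exists j; auto|].
    intros q (i & Hi & ->).
    destruct (Nat.eq_dec i j) as [->|Hij]; auto. }
  destruct j as [|j].
  { apply (E eps 0); intros i Hi Hi0.
    assert (H := Hx 0%nat i ltac:(lia)); lra. }
  destruct (Nat.eq_dec (S (S j)) k) as [Hk|Hk].
  { apply (E (- eps) 0); intros i Hi Hi0.
    assert (H := Hx i (S j) ltac:(lia)); lra. }
  (* the functional is constant on the direction from x j to x (j + 2) *)
  apply (E (- (snd (x (S (S j))) - snd (x j))) (fst (x (S (S j))) - fst (x j))).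
  intros i Hi Hij.
  assert (H1 : 0 <= orient (x j) (x (S j)) (x i)).
  { destruct (Nat.lt_trichotomy i j) as [H|[->|H]].
    - assert (K := Ho i j (S j) ltac:(lia) ltac:(lia)); unfold orient in *; lra.
    - unfold orient; lra.
    - apply Rlt_le, Ho; lia. }
  assert (H2 : 0 <= orient (x (S j)) (x (S (S j))) (x i)).
  { destruct (Nat.lt_trichotomy i (S (S j))) as [H|[->|H]].
    - assert (K := Ho i (S j) (S (S j)) ltac:(lia) ltac:(lia)); unfold orient in *; lra.
    - unfold orient; lra.
    - apply Rlt_le, Ho; lia. }
  (* The sum of these two orientations is the functional at [x i] minus its value at [x (S j)]; at
     least one of them is positive. *)
  assert (H3 : 0 < orient (x j) (x (S j)) (x i) + orient (x (S j)) (x (S (S j))) (x i)).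
  { destruct (Nat.eq_dec i j) as [->|Hne].
    - assert (K := Ho j (S j) (S (S j)) ltac:(lia) ltac:(lia)); unfold orient in *; lra.
    - assert (0 < orient (x j) (x (S j)) (x i)); [|lra].
      destruct (Nat.lt_trichotomy i j) as [H|[H|H]]; [|lia|apply Ho; lia].
      assert (K := Ho i j (S j) ltac:(lia) ltac:(lia)); unfold orient in *; lra. }
  unfold orient in *; lra.
Qed.

(** * Upper envelope of a concave chain of lines *)

(** Strict concavity of the points [(M t, B t)] dual to the lines [Y = M t * X + B t], with the
    denominators of the edge slopes cleared. *)
Definition concave_chain (n : nat) (M B : nat -> R) : Prop :=
  (forall t u, (t < u < n)%nat -> M t < M u) /\
  (forall t u v, (t < u)%nat -> (u < v < n)%nat ->
     (B v - B u) * (M u - M t) < (B u - B t) * (M v - M u)).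

(** Lines [t] and [u] cross where [X] is minus the slope of the dual edge from [t] to [u]. The edge
    from [u] to [v] has smaller slope, which puts line [v] below the crossing. *)
Lemma crossing_above_later (n : nat) (M B : nat -> R) (t u v : nat) (X Y : R) :
  concave_chain n M B -> (t < u)%nat -> (u < v < n)%nat ->
  Y = M t * X + B t -> Y = M u * X + B u -> M v * X + B v < Y.
Proof.
  intros [HM HB] Htu Huv H1 H2.
  assert (K1 := HM t u ltac:(lia)); assert (K2 := HM u v ltac:(lia)).
  assert (K := HB t u v Htu Huv).
  apply (Rmult_lt_reg_l (M u - M t)); [lra|].
  assert (E : B u - B t = - X * (M u - M t)) by lra.
  rewrite E in K; rewrite H2.
  nra.
Qed.

Lemma crossing_above_earlier (n : nat) (M B : nat -> R) (t u v : nat) (X Y : R) :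
  concave_chain n M B -> (t < u)%nat -> (u < v < n)%nat ->
  Y = M u * X + B u -> Y = M v * X + B v -> M t * X + B t < Y.
Proof.
  intros [HM HB] Htu Huv H1 H2.
  assert (K1 := HM t u ltac:(lia)); assert (K2 := HM u v ltac:(lia)).
  assert (K := HB t u v Htu Huv).
  apply (Rmult_lt_reg_l (M v - M u)); [lra|].
  assert (E : B v - B u = - X * (M v - M u)) by lra.
  rewrite E in K; rewrite H1.
  nra.
Qed.

(** When [u = S t] every [w] qualifies, so crossings of neighbouring lines lie on the upper
    envelope. *)
Lemma crossing_above (n : nat) (M B : nat -> R) (t u w : nat) (X Y : R) :
  concave_chain n M B -> (t < u < n)%nat -> (w < n)%nat ->
  (w <= t \/ u <= w)%nat ->
  Y = M t * X + B t -> Y = M u * X + B u -> M w * X + B w <= Y.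
Proof.
  intros H Htu Hw Hc H1 H2.
  destruct (Nat.eq_dec w t) as [->|N1]; [lra|].
  destruct (Nat.eq_dec w u) as [->|N2]; [lra|].
  destruct Hc.
  - apply Rlt_le, (crossing_above_earlier n M B w t u); auto; lia.
  - apply Rlt_le, (crossing_above_later n M B t u w); auto; lia.
Qed.

Lemma crossing_exists (m1 m2 b1 b2 : R) :
  m1 < m2 -> exists X Y, Y = m1 * X + b1 /\ Y = m2 * X + b2.
Proof.
  intros H; exists (- (b2 - b1) / (m2 - m1)), (m1 * (- (b2 - b1) / (m2 - m1)) + b1).
  split; [auto | field; lra].
Qed.

(** The second line minus the first increases with the abscissa; it is at most 0 at [X] and at least
    0 at [X']. Crossings are ordered from left to right by such comparisons. *)
Lemma crossing_le (m1 m2 b1 b2 X Y X' Y' : R) :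
  m1 < m2 -> Y = m1 * X + b1 -> m2 * X + b2 <= Y ->
  Y' = m2 * X' + b2 -> m1 * X' + b1 <= Y' -> X <= X'.
Proof. intros; apply (Rmult_le_reg_l (m2 - m1)); lra. Qed.

Lemma crossing_lt (m1 m2 b1 b2 X Y X' Y' : R) :
  m1 < m2 -> Y = m1 * X + b1 -> m2 * X + b2 < Y ->
  Y' = m2 * X' + b2 -> m1 * X' + b1 <= Y' -> X < X'.
Proof. intros; apply (Rmult_lt_reg_l (m2 - m1)); lra. Qed.

(* The separating line joins the two extreme vertices (X1, Y1) and (X2, Y2) of the upper
   envelope of the block f, ..., g. *)
Lemma block_separation (n : nat) (M B : nat -> R) (f g : nat) :
  concave_chain n M B -> (S f < g < n)%nat ->
  exists X1 X2 s d, forall t u X Y, (t < u < n)%nat ->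
    Y = M t * X + B t -> Y = M u * X + B u ->
    ((f <= t)%nat -> (u <= g)%nat -> X1 <= X <= X2 /\ Y <= s * X + d) /\
    ((u < f)%nat -> X < X1 /\ s * X + d < Y) /\
    ((g < t)%nat -> X2 < X /\ s * X + d < Y).
Proof.
  intros H Hfg.
  assert (HM := proj1 H).
  destruct g as [|g']; [lia|].
  destruct (crossing_exists (M f) (M (S f)) (B f) (B (S f))) as (X1 & Y1 & P1 & P1');
    [apply HM; lia|].
  destruct (crossing_exists (M g') (M (S g')) (B g') (B (S g'))) as (X2 & Y2 & P2 & P2');
    [apply HM; lia|].
  assert (A1 : forall w, (w < n)%nat -> (w <= f \/ S f <= w)%nat -> M w * X1 + B w <= Y1).
  { intros; apply (crossing_above n M B f (S f)); auto; lia. }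
  assert (A2 : forall w, (w < n)%nat -> (w <= g' \/ S g' <= w)%nat -> M w * X2 + B w <= Y2).
  { intros; apply (crossing_above n M B g' (S g')); auto; lia. }
  (* The block has at least three lines, so line [S g'] is strictly below the first vertex while it
     passes through the second. *)
  assert (X12 : X1 < X2).
  { apply (crossing_lt (M f) (M (S g')) (B f) (B (S g')) X1 Y1 X2 Y2); auto.
    - apply HM; lia.
    - apply (crossing_above_later n M B f (S f) (S g')); auto; lia.
    - apply A2; lia. }
  set (s := (Y2 - Y1) / (X2 - X1)).
  assert (Hs : s * (X2 - X1) = Y2 - Y1) by (unfold s; field; lra).
  (* Line [f] passes through the first vertex and weakly below the second, line [S g'] the other way
     round, so the chord slope lies between theirs. *)
  assert (Hs1 : M f <= s).
  { assert (K := A2 f ltac:(lia) ltac:(lia)).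
    apply (Rmult_le_reg_r (X2 - X1)); lra. }
  assert (Hs2 : s <= M (S g')).
  { assert (K := A1 (S g') ltac:(lia) ltac:(lia)).
    apply (Rmult_le_reg_r (X2 - X1)); lra. }
  exists X1, X2, s, (Y1 - s * X1).
  intros t u X Y Htu E1 E2.
  split; [|split].
  - intros Hft Hug.
    assert (L1 : X1 <= X).
    { apply (crossing_le (M f) (M u) (B f) (B u) X1 Y1 X Y); auto.
      - apply HM; lia.
      - apply A1; lia.
      - apply (crossing_above n M B t u); auto; lia. }
    assert (L2 : X <= X2).
    { apply (crossing_le (M t) (M (S g')) (B t) (B (S g')) X Y X2 Y2); auto.
      - apply HM; lia.
      - apply (crossing_above n M B t u); auto; lia.
      - apply A2; lia. }
    split; [lra|].
    (* line t lies weakly below both extreme vertices, hence below the chord *)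
    assert (K2 : M t * X2 + B t <= Y2) by (apply A2; lia).
    destruct (Nat.eq_dec t f) as [->|Ntf].
    + assert ((s - M f) * (X - X1) >= 0) by (apply Rle_ge, Rmult_le_pos; lra). lra.
    + assert (K1 : M t * X1 + B t <= Y1) by (apply A1; lia).
      apply (Rmult_le_reg_r (X2 - X1)); [lra|].
      assert (0 <= (X2 - X) * (Y1 - (M t * X1 + B t))) by (apply Rmult_le_pos; lra).
      assert (0 <= (X - X1) * (Y2 - (M t * X2 + B t))) by (apply Rmult_le_pos; lra).
      assert (E : (s * X + (Y1 - s * X1)) * (X2 - X1)
        = (X - X1) * (s * (X2 - X1)) + Y1 * (X2 - X1)) by ring.
      rewrite E, Hs, E1; lra.
  (* To the left of [X1] the chord is weakly below line [f], which is strictly below every crossing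
     of earlier lines. The last case is the mirror image. *)
  - intros Huf.
    assert (K : M f * X + B f < Y)
      by (apply (crossing_above_later n M B t u f); auto; lia).
    assert (L : X < X1).
    { apply (crossing_lt (M u) (M f) (B u) (B f) X Y X1 Y1); auto.
      - apply HM; lia.
      - apply A1; lia. }
    split; [auto|].
    assert ((s - M f) * (X1 - X) >= 0) by (apply Rle_ge, Rmult_le_pos; lra). lra.
  - intros Hgt.
    assert (K : M (S g') * X + B (S g') < Y)
      by (apply (crossing_above_earlier n M B (S g') t u); auto; lia).
    assert (L : X2 < X).
    { apply (crossing_lt (M (S g')) (M t) (B (S g')) (B t) X2 Y2 X Y); auto.
      - apply HM; lia.
      - apply (crossing_above_later n M B g' (S g') t); auto; lia.
      - lra. }
    split; [auto|].
    assert ((M (S g') - s) * (X - X2) >= 0) by (apply Rle_ge, Rmult_le_pos; lra). lra.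
Qed.

(** * Strict concavity by thinning a weakly concave chain *)

Lemma slope_sum_ge (M B : nat -> R) (a : R) (t k : nat) :
  (forall i, (t <= i < t + k)%nat -> a * (M (S i) - M i) <= B (S i) - B i) ->
  a * (M (t + k)%nat - M t) <= B (t + k)%nat - B t.
Proof.
  induction k as [|k IH]; intros H.
  - rewrite Nat.add_0_r; lra.
  - assert (K := H (t + k)%nat ltac:(lia)).
    rewrite Nat.add_succ_r.
    assert (a * (M (t + k)%nat - M t) <= B (t + k)%nat - B t) by (apply IH; intros; apply H; lia).
    lra.
Qed.

Lemma increasing_of_steps (n : nat) (M : nat -> R) :
  (forall i, (i < n)%nat -> M i < M (S i)) ->
  forall t u, (t < u <= n)%nat -> M t < M u.
Proof.
  intros H t u; induction u as [|u IH]; intros Hu; [lia|].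
  assert (K := H u ltac:(lia)).
  destruct (Nat.eq_dec t u) as [->|Htu]; auto.
  assert (M t < M u) by (apply IH; lia); lra.
Qed.

Lemma nonincreasing_of_steps (n : nat) (e : nat -> R) :
  (forall i, (S i < n)%nat -> e (S i) <= e i) ->
  forall t u, (t <= u < n)%nat -> e u <= e t.
Proof.
  intros H t u; induction u as [|u IH]; intros Hu.
  - replace t with 0%nat by lia; lra.
  - destruct (Nat.eq_dec t (S u)) as [->|Htu]; [lra|].
    assert (K := H u ltac:(lia)). assert (e u <= e t) by (apply IH; lia); lra.
Qed.

Definition edge_slope (M B : nat -> R) (i : nat) : R := (B (S i) - B i) / (M (S i) - M i).

Lemma edge_slope_mul (M B : nat -> R) (i : nat) :
  M i < M (S i) -> edge_slope M B i * (M (S i) - M i) = B (S i) - B i.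
Proof. intros; unfold edge_slope; field; lra. Qed.

(** Compare with the slope [a] of the last edge before the middle point: later edges have slope at
    most [a], earlier ones at least [a], and the first edge strictly more, being at least [r] edges
    earlier. *)
Lemma concave_subsample (n m r : nat) (M B : nat -> R) :
  (forall i, (i < n)%nat -> M i < M (S i)) ->
  (forall i, (S i < n)%nat -> edge_slope M B (S i) <= edge_slope M B i) ->
  (forall i, (i + r < n)%nat -> edge_slope M B (i + r) < edge_slope M B i) ->
  (m * S r <= n)%nat ->
  concave_chain m (fun t => M (t * S r)%nat) (fun t => B (t * S r)%nat).
Proof.
  intros HM He Hr Hm.
  assert (HM' := increasing_of_steps n M HM).
  assert (He' := nonincreasing_of_steps n _ He).
  split; [intros t u Htu; apply HM'; nia|].
  intros t u v Htu Huv.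
  (* The middle index is written [S U] so that edge [U] ends there; [T + r <= U] because samples are
     at least [S r] apart. *)
  assert (exists T U V, (t * S r = T /\ u * S r = S U /\ v * S r = V /\ T + r <= U /\ S U < V <= n)%nat)
    as (T & U & V & -> & -> & -> & HTU & HUV).
  { exists (t * S r)%nat, (u * S r - 1)%nat, (v * S r)%nat; nia. }
  clear t u v Htu Huv.
  set (a := edge_slope M B U).
  assert (HTlt : a < edge_slope M B T).
  { apply Rle_lt_trans with (edge_slope M B (T + r)); [apply He'; lia | apply Hr; lia]. }
  assert (K1 : B V - B (S U) <= a * (M V - M (S U))).
  { assert (K := slope_sum_ge M (fun i => - B i) (- a) (S U) (V - S U)).
    replace (S U + (V - S U))%nat with V in K by lia.
    assert (- a * (M V - M (S U)) <= - B V - - B (S U)); [apply K|lra].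
    intros i Hi.
    assert (Ei := edge_slope_mul M B i (HM i ltac:(lia))).
    assert (Mi := HM i ltac:(lia)).
    assert (edge_slope M B i <= a) by (apply He'; lia).
    assert (0 <= (a - edge_slope M B i) * (M (S i) - M i)) by (apply Rmult_le_pos; lra).
    lra. }
  assert (K2 : a * (M (S U) - M T) < B (S U) - B T).
  { assert (K := slope_sum_ge M B a (S T) (U - T)).
    replace (S T + (U - T))%nat with (S U) in K by lia.
    assert (a * (M (S U) - M (S T)) <= B (S U) - B (S T)).
    { apply K; intros i Hi.
      assert (Ei := edge_slope_mul M B i (HM i ltac:(lia))).
      assert (Mi := HM i ltac:(lia)).
      assert (a <= edge_slope M B i) by (apply He'; lia).
      assert (0 <= (edge_slope M B i - a) * (M (S i) - M i)) by (apply Rmult_le_pos; lra).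
      lra. }
    assert (ET := edge_slope_mul M B T (HM T ltac:(lia))).
    assert (MT := HM T ltac:(lia)).
    assert (0 < (edge_slope M B T - a) * (M (S T) - M T)) by (apply Rmult_lt_0_compat; lra).
    lra. }
  assert (M1 : M T < M (S U)) by (apply HM'; lia).
  assert (M2 : M (S U) < M V) by (apply HM'; lia).
  apply Rle_lt_trans with (a * (M V - M (S U)) * (M (S U) - M T)).
  - apply Rmult_le_compat_r; lra.
  - replace (a * (M V - M (S U)) * (M (S U) - M T))
      with (a * (M (S U) - M T) * (M V - M (S U))) by ring.
    apply Rmult_lt_compat_r; lra.
Qed.

(** * Slopes, intercepts and parallel lines *)

Definition vertical (l : line) : Prop := let '(_, b, _) := l in b = 0.
Definition slope (l : line) : R := let '(a, b, _) := l in - a / b.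
Definition intercept (l : line) : R := let '(_, b, c) := l in c / b.

Lemma on_line_slope (l : line) (p : point) :
  ~ vertical l -> (on_line l p <-> snd p = slope l * fst p + intercept l).
Proof.
  destruct l as [[a b] c]; simpl; intros Hb; split; intros H.
  - rewrite <- H; field; auto.
  - rewrite H; field; auto.
Qed.

Lemma same_slope_meet (l1 l2 : line) (p : point) :
  ~ vertical l1 -> ~ vertical l2 -> slope l1 = slope l2 ->
  on_line l1 p -> on_line l2 p -> same_line l1 l2.
Proof.
  intros H1 H2 E P1 P2 q.
  rewrite on_line_slope in P1, P2 by auto.
  rewrite !on_line_slope, E by auto; rewrite E in P1.
  replace (intercept l2) with (intercept l1) by lra; tauto.
Qed.

Lemma vertical_meet (l1 l2 : line) (p : point) :
  nondeg l1 -> nondeg l2 -> vertical l1 -> vertical l2 ->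
  on_line l1 p -> on_line l2 p -> same_line l1 l2.
Proof.
  destruct l1 as [[a1 b1] c1], l2 as [[a2 b2] c2]; simpl.
  intros H1 H2 -> -> <- <- q; simpl.
  assert (a1 <> 0) by (destruct H1; congruence).
  assert (a2 <> 0) by (destruct H2; congruence).
  split; intros E; (assert (fst q = fst p) as ->; [|ring]).
  - apply (Rmult_eq_reg_l a1); auto; lra.
  - apply (Rmult_eq_reg_l a2); auto; lra.
Qed.

(** * Blocks of lines and their transversals *)

Definition block (c : nat) (s : nat -> nat) (i : nat) : list nat :=
  map s (seq (i * c) c).

Lemma in_block c s i j :
  In j (block c s i) <-> exists t, (i * c <= t < i * c + c)%nat /\ j = s t.
Proof.
  unfold block; rewrite in_map_iff; split.
  - intros (t & <- & Ht); exists t; rewrite in_seq in Ht; split; auto; lia.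
  - intros (t & Ht & ->); exists t; rewrite in_seq; auto.
Qed.

Lemma NoDup_map_seq (s : nat -> nat) (a n : nat) :
  (forall t u, (a <= t < u)%nat -> (u < a + n)%nat -> s t <> s u) ->
  NoDup (map s (seq a n)).
Proof.
  revert a; induction n as [|n IH]; intros a H; simpl; constructor.
  - rewrite in_map_iff; intros (t & E & Ht); rewrite in_seq in Ht.
    apply (H a t); auto; lia.
  - apply IH; intros; apply H; lia.
Qed.

Lemma blocks_disjoint (N k c : nat) (s : nat -> nat) :
  (forall t, (t < k * c)%nat -> (s t < N)%nat) ->
  (forall t u, (t < u < k * c)%nat -> s t <> s u) ->
  (forall i, (i < k)%nat ->
     NoDup (block c s i) /\ (forall j, In j (block c s i) -> (j < N)%nat) /\
     (c <= length (block c s i))%nat) /\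
  (forall i i', (i < k)%nat -> (i' < k)%nat -> i <> i' ->
     forall j, In j (block c s i) -> ~ In j (block c s i')).
Proof.
  intros HN Hinj; split.
  - intros i Hi; assert (i * c + c <= k * c)%nat by nia; split; [|split].
    + apply NoDup_map_seq; intros; apply Hinj; lia.
    + intros j Hj; apply in_block in Hj as (t & Ht & ->); apply HN; lia.
    + unfold block; rewrite length_map, length_seq; lia.
  - intros i i' Hi Hi' Hii j Hj Hj'.
    apply in_block in Hj as (t & Ht & ->); apply in_block in Hj' as (t' & Ht' & E).
    assert (i * c + c <= k * c)%nat by nia; assert (i' * c + c <= k * c)%nat by nia.
    destruct (Nat.lt_trichotomy t t') as [H1|[H1|H1]].
    + apply (Hinj t t'); auto; lia.
    + subst t'; destruct (Nat.lt_trichotomy i i') as [H2|[H2|H2]]; try lia; nia.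
    + apply (Hinj t' t); auto; lia.
Qed.

(** Reflection through the origin keeps slopes and negates intercepts, hence [eps] multiplies both
    coordinates and the intercept but not the slope. *)
Lemma V_block_crossing (A : nat -> line) (c : nat) (s : nat -> nat) (i : nat) (eps : R)
    (p : point) :
  (forall t, (i * c <= t < i * c + c)%nat -> ~ vertical (A (s t))) ->
  V A (block c s i) p ->
  exists t u, (i * c <= t)%nat /\ (t < u < i * c + c)%nat /\
    eps * snd p = slope (A (s t)) * (eps * fst p) + eps * intercept (A (s t)) /\
    eps * snd p = slope (A (s u)) * (eps * fst p) + eps * intercept (A (s u)).
Proof.
  intros Hv (j1 & j2 & H1 & H2 & Hne & P1 & P2).
  apply in_block in H1 as (t & Ht & ->); apply in_block in H2 as (u & Hu & ->).
  rewrite on_line_slope in P1, P2 by auto.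
  destruct (Nat.lt_trichotomy t u) as [H|[->|H]]; [|congruence|].
  - exists t, u; repeat split; try lia; [rewrite P1|rewrite P2]; ring.
  - exists u, t; repeat split; try lia; [rewrite P2|rewrite P1]; ring.
Qed.

(** Linear inequalities on the crossings of a block pass to its hull. For [i < j < l], after the
    reflection, the separating line of block [j] has [x j] weakly below it and [x i], [x l] strictly
    above, to the left and right, so the triple turns left. *)
Lemma blocks_transversal (A : nat -> line) (k c : nat) (eps : R) (s : nat -> nat)
    (x : nat -> point) :
  eps = 1 \/ eps = -1 -> (3 <= c)%nat ->
  (forall t, (t < k * c)%nat -> ~ vertical (A (s t))) ->
  concave_chain (k * c) (fun t => slope (A (s t))) (fun t => eps * intercept (A (s t))) ->
  (forall i, (i < k)%nat -> CH A (block c s i) (x i)) ->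
  convex_position (fun p => exists i, (i < k)%nat /\ p = x i).
Proof.
  intros Heps Hc Hv Hch Hx.
  assert (HS : forall j, (j < k)%nat -> exists X1 X2 a d,
    (X1 <= eps * fst (x j) <= X2 /\ eps * snd (x j) <= a * (eps * fst (x j)) + d) /\
    (forall i, (i < k)%nat ->
      ((i < j)%nat -> eps * fst (x i) < X1 /\ a * (eps * fst (x i)) + d < eps * snd (x i)) /\
      ((j < i)%nat -> X2 < eps * fst (x i) /\ a * (eps * fst (x i)) + d < eps * snd (x i)))).
  { intros j Hj.
    assert (j * c + c <= k * c)%nat by nia.
    (* Since [c >= 3], some index lies strictly between the first and the last of the block, as the
       separation requires. *)
    destruct (block_separation _ _ _ (j * c) (j * c + (c - 1)) Hch) as (X1 & X2 & a & d & Hsep);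
      [lia|].
    exists X1, X2, a, d.
    assert (HV : forall i p, (i < k)%nat -> V A (block c s i) p ->
      (i = j -> X1 <= eps * fst p <= X2 /\ eps * snd p <= a * (eps * fst p) + d) /\
      ((i < j)%nat -> eps * fst p < X1 /\ a * (eps * fst p) + d < eps * snd p) /\
      ((j < i)%nat -> X2 < eps * fst p /\ a * (eps * fst p) + d < eps * snd p)).
    { intros i p Hi Hp.
      assert (i * c + c <= k * c)%nat by nia.
      apply (V_block_crossing A c s i eps) in Hp as (t & u & Ht & Htu & E1 & E2);
        [|intros; apply Hv; lia].
      destruct (Hsep t u _ _ ltac:(lia) E1 E2) as (S1 & S2 & S3).
      split; [|split]; intros Hij.
      - subst i; apply S1; lia.
      - apply S2; nia.
      - apply S3; nia. }
    split.
    - assert (D := Hx j Hj).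
      assert (eps * fst (x j) + 0 * snd (x j) <= X2).
      { revert D; apply conv_le; intros q Hq; apply (HV j) in Hq; [|auto].
        apply proj1 in Hq; specialize (Hq eq_refl); lra. }
      assert (- eps * fst (x j) + 0 * snd (x j) <= - X1).
      { revert D; apply conv_le; intros q Hq; apply (HV j) in Hq; [|auto].
        apply proj1 in Hq; specialize (Hq eq_refl); lra. }
      assert (- (a * eps) * fst (x j) + eps * snd (x j) <= d).
      { revert D; apply conv_le; intros q Hq; apply (HV j) in Hq; [|auto].
        apply proj1 in Hq; specialize (Hq eq_refl); lra. }
      lra.
    - intros i Hi; assert (D := Hx i Hi); split; intros Hij.
      + assert (eps * fst (x i) + 0 * snd (x i) < X1).
        { revert D; apply conv_lt; intros q Hq; apply HV in Hq; [|auto].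
          apply proj2, proj1 in Hq; specialize (Hq Hij); lra. }
        assert ((a * eps) * fst (x i) + - eps * snd (x i) < - d).
        { revert D; apply conv_lt; intros q Hq; apply HV in Hq; [|auto].
          apply proj2, proj1 in Hq; specialize (Hq Hij); lra. }
        lra.
      + assert (- eps * fst (x i) + 0 * snd (x i) < - X2).
        { revert D; apply conv_lt; intros q Hq; apply HV in Hq; [|auto].
          apply proj2, proj2 in Hq; specialize (Hq Hij); lra. }
        assert ((a * eps) * fst (x i) + - eps * snd (x i) < - d).
        { revert D; apply conv_lt; intros q Hq; apply HV in Hq; [|auto].
          apply proj2, proj2 in Hq; specialize (Hq Hij); lra. }
        lra. }
  apply (convex_chain_convex_position k eps).
  - intros i j Hij.
    destruct (HS j ltac:(lia)) as (X1 & X2 & a & d & H1 & H2).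
    destruct (proj1 (H2 i ltac:(lia)) (proj1 Hij)) as [I1 _]; lra.
  - intros i j l Hij Hjl.
    destruct (HS j ltac:(lia)) as (X1 & X2 & a & d & H1 & H2).
    destruct (proj1 (H2 i ltac:(lia)) Hij) as [I1 I2].
    destruct (proj2 (H2 l ltac:(lia)) (proj1 Hjl)) as [L1 L2].
    (* [h] is the height above the separating line after the reflection. The shear that flattens
       this line and the reflection both preserve the orientation determinant, which becomes a sum
       of two positive products. *)
    set (h := fun p : point => eps * snd p - a * (eps * fst p) - d).
    assert (E : orient (x i) (x j) (x l) =
      (eps * fst (x j) - eps * fst (x i)) * (h (x l) - h (x j)) +
      (h (x i) - h (x j)) * (eps * fst (x l) - eps * fst (x j))).
    { unfold orient, h; destruct Heps as [-> | ->]; ring. }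
    rewrite E.
    apply Rplus_lt_0_compat; apply Rmult_lt_0_compat; unfold h; lra.
Qed.

(** One block with empty hull suffices: then no transversal exists and the claim about transversals
    is vacuous. *)
Lemma parallel_blocks (N k c : nat) (A : nat -> line) (l : list nat) :
  (0 < k)%nat ->
  (forall i j p, In i l -> In j l -> i <> j -> on_line (A i) p -> ~ on_line (A j) p) ->
  NoDup l -> (forall i, In i l -> (i < N)%nat) -> (k * c <= length l)%nat ->
  exists s, (forall t, (t < k * c)%nat -> (s t < N)%nat) /\
    (forall t u, (t < u < k * c)%nat -> s t <> s u) /\
    (forall p, ~ CH A (block c s 0) p).
Proof.
  intros Hk Hp Hl HN Hlen.
  exists (fun t => nth t l 0%nat); split; [|split].
  - intros t Ht; apply HN, nth_In; lia.
  - intros t u Htu E; apply NoDup_nth in E; auto; lia.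
  - apply conv_empty; intros q (i & j & Hi & Hj & Hne & P1 & P2).
    apply in_block in Hi as (t & Ht & ->); apply in_block in Hj as (u & Hu & ->).
    assert (c <= k * c)%nat by nia.
    eapply Hp; [| | exact Hne | exact P1 | exact P2]; apply nth_In; lia.
Qed.

(* A weakly convex or concave chain on the dual points (slope, intercept) becomes strict after
   keeping every (r+1)-st point: an edge slope that persists over r+1 edges would give r+2
   concurrent lines. *)
Lemma concave_chain_of_weak (N n m r : nat) (A : nat -> line) (eps : R) (s : nat -> nat) :
  eps = 1 \/ eps = -1 -> no_r1_concurrent N r A ->
  (forall i, (i <= n)%nat -> (s i < N)%nat /\ ~ vertical (A (s i))) ->
  (forall i, (i < n)%nat -> slope (A (s i)) < slope (A (s (S i)))) ->
  (forall i, (S i < n)%nat ->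
     edge_slope (fun t => slope (A (s t))) (fun t => eps * intercept (A (s t))) (S i) <=
     edge_slope (fun t => slope (A (s t))) (fun t => eps * intercept (A (s t))) i) ->
  (m * S r <= n)%nat ->
  concave_chain m (fun t => slope (A (s (t * S r)%nat)))
    (fun t => eps * intercept (A (s (t * S r)%nat))).
Proof.
  intros Heps Hr Hs HM He Hm.
  set (M := fun t => slope (A (s t))) in *.
  set (B := fun t => eps * intercept (A (s t))) in *.
  apply (concave_subsample n m r M B); auto.
  intros i Hi.
  assert (He' := nonincreasing_of_steps n _ He).
  destruct (Rle_lt_or_eq_dec _ _ (He' i (i + r)%nat ltac:(lia))) as [H|E]; auto.
  exfalso.
  set (e := edge_slope M B i) in *.
  (* Equal slopes at edges [i] and [i + r] force all edges between them to have slope [e], so the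
     dual points [i] to [i + S r] are collinear. *)
  assert (Hcol : forall w, (w <= S r)%nat -> B (i + w)%nat - e * M (i + w)%nat = B i - e * M i).
  { induction w as [|w IH]; intros Hw; [rewrite Nat.add_0_r; auto|].
    rewrite <- IH by lia.
    assert (Ew : edge_slope M B (i + w) = e).
    { apply Rle_antisym; [apply He'; lia|].
      rewrite <- E; apply He'; lia. }
    assert (K := edge_slope_mul M B (i + w) (HM (i + w)%nat ltac:(lia))).
    rewrite Ew in K; rewrite Nat.add_succ_r; lra. }
  assert (HM' := increasing_of_steps n M HM).
  (* The common point is dual to the line through these points: slope [e] gives the abscissa [-e],
     and [eps] undoes the reflection. *)
  assert (Hlen := Hr (- (eps * e), eps * (B i - e * M i)) (map s (seq i (S r)))).
  rewrite length_map, length_seq in Hlen.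
  assert (S r <= r)%nat; [apply Hlen | lia].
  - apply NoDup_map_seq; intros t u Ht Hu Hst.
    assert (K : M t < M u) by (apply HM'; lia).
    unfold M in K; rewrite Hst in K; lra.
  - intros j Hj; apply in_map_iff in Hj as (t & <- & Ht); apply in_seq in Ht.
    split; [apply Hs; lia|].
    apply on_line_slope; [apply Hs; lia|]; simpl.
    assert (K := Hcol (t - i)%nat ltac:(lia)).
    replace (i + (t - i))%nat with t in K by lia.
    rewrite <- K; unfold M, B; destruct Heps as [-> | ->]; ring.
Qed.

(** * From many lines to the groups *)

Lemma edge_slope_le (M B : nat -> R) (i : nat) :
  M i < M (S i) -> M (S i) < M (S (S i)) ->
  (B (S (S i)) - B (S i)) * (M (S i) - M i) <= (B (S i) - B i) * (M (S (S i)) - M (S i)) ->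
  edge_slope M B (S i) <= edge_slope M B i.
Proof.
  intros H1 H2 H.
  apply (Rmult_le_reg_r ((M (S (S i)) - M (S i)) * (M (S i) - M i))).
  { apply Rmult_lt_0_compat; lra. }
  unfold edge_slope.
  match goal with |- ?a <= ?b =>
    replace a with ((B (S (S i)) - B (S i)) * (M (S i) - M i)) by (field; lra);
    replace b with ((B (S i) - B i) * (M (S (S i)) - M (S i))) by (field; lra) end.
  exact H.
Qed.

Theorem mainTheorem12 :
  forall k r c : nat, (0 < k)%nat -> (0 < r)%nat -> (0 < c)%nat ->
  exists N : nat,
    forall A : nat -> line,
      (forall i, (i < N)%nat -> nondeg (A i)) ->
      (forall i j, (i < N)%nat -> (j < N)%nat -> i <> j -> ~ same_line (A i) (A j)) ->
      no_r1_concurrent N r A ->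
      exists As : nat -> list nat,
        (forall i, (i < k)%nat ->
           NoDup (As i) /\ (forall j, In j (As i) -> (j < N)%nat) /\
           (c <= length (As i))%nat) /\
        (forall i i', (i < k)%nat -> (i' < k)%nat -> i <> i' ->
           forall j, In j (As i) -> ~ In j (As i')) /\
        (forall x : nat -> point,
           (forall i, (i < k)%nat -> CH A (As i) (x i)) ->
           convex_position (fun p => exists i, (i < k)%nat /\ p = x i)).
Proof.
  intros k r c0 Hk _ _.
  (* Adding 3 gives every block at least three lines; [n] edges leave [k * c] points when every
     [S r]-th point is kept. *)
  set (c := (c0 + 3)%nat); set (n := (k * c * S r)%nat).
  destruct (@cups_caps nat n n) as [N0 HN0].
  (* Fewer than [k * c] vertical lines leave enough others for the pigeonhole on slopes, and [N0]
     distinct slopes feed the cups-caps recursion. *)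
  exists (k * c + S (k * c) * N0)%nat.
  set (N := (k * c + S (k * c) * N0)%nat).
  intros A Hnd Hsame Hconc.
  (* This serves both parallel families: vertical lines and lines of one common slope. *)
  assert (Hpar : forall l : list nat,
    (forall i j p, In i l -> In j l -> on_line (A i) p -> on_line (A j) p ->
       same_line (A i) (A j)) ->
    NoDup l -> (forall i, In i l -> (i < N)%nat) -> (k * c <= length l)%nat ->
    exists s, (forall t, (t < k * c)%nat -> (s t < N)%nat) /\
      (forall t u, (t < u < k * c)%nat -> s t <> s u) /\
      (forall x, (forall i, (i < k)%nat -> CH A (block c s i) (x i)) ->
        convex_position (fun p => exists i, (i < k)%nat /\ p = x i))).
  { intros l Hl1 Hl2 Hl3 Hl4.
    destruct (parallel_blocks N k c A l Hk) as (s & S1 & S2 & S3); auto.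
    - intros i j p Hi Hj Hij P1 P2.
      apply (Hsame i j (Hl3 i Hi) (Hl3 j Hj) Hij), (Hl1 i j p); auto.
    - exists s; split; [|split]; auto.
      intros x Hx; exfalso; apply (S3 (x 0%nat)), Hx; auto. }
  assert (H : exists s, (forall t, (t < k * c)%nat -> (s t < N)%nat) /\
      (forall t u, (t < u < k * c)%nat -> s t <> s u) /\
      (forall x, (forall i, (i < k)%nat -> CH A (block c s i) (x i)) ->
        convex_position (fun p => exists i, (i < k)%nat /\ p = x i))).
  2: { destruct H as (s & S1 & S2 & S3).
    destruct (blocks_disjoint N k c s S1 S2) as [B1 B2].
    exists (block c s); split; [|split]; auto.
    intros i Hi; destruct (B1 i Hi) as (C1 & C2 & C3); repeat split; auto; lia. }
  destruct (list_partition (fun i => vertical (A i)) (seq 0 N) (seq_NoDup _ _))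
    as (l1 & l2 & D1 & D2 & H1 & H2 & Hsum).
  rewrite length_seq in Hsum.
  assert (L1 : forall i, In i l1 -> (i < N)%nat).
  { intros i Hi; apply H1 in Hi; rewrite in_seq in Hi; lia. }
  assert (L2 : forall i, In i l2 -> (i < N)%nat).
  { intros i Hi; apply H2 in Hi; rewrite in_seq in Hi; lia. }
  destruct (Nat.le_gt_cases (k * c) (length l1)) as [Hv|Hv].
  { apply (Hpar l1); auto.
    intros i j p Hi Hj; apply vertical_meet; auto; apply H1; auto. }
  destruct (pigeonhole_fibres (fun i => slope (A i)) (k * c) N0 l2 D2)
    as [(l & z & K1 & K2 & K3)|(l & K1 & K2 & K3 & K4)]; [lia| |].
  { apply (Hpar l); auto.
    - intros i j p Hi Hj; apply K2 in Hi as [Hi Ei], Hj as [Hj Ej].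
      apply same_slope_meet; [apply H2; auto.. | congruence].
    - intros i Hi; apply L2, K2, Hi. }
  assert (Hweak : exists eps s, (eps = 1 \/ eps = -1) /\
    (forall i, (i <= n)%nat -> In (s i) l) /\
    (forall i, (i < n)%nat -> slope (A (s i)) < slope (A (s (S i)))) /\
    (forall i, (S i < n)%nat ->
     edge_slope (fun t => slope (A (s t))) (fun t => eps * intercept (A (s t))) (S i) <=
     edge_slope (fun t => slope (A (s t))) (fun t => eps * intercept (A (s t))) i)).
  (* The relation is strict convexity of the dual points. Its chains become concave on negating the
     intercepts; chains of its negation are already weakly concave. *)
  { destruct (HN0 (fun i j => slope (A i) < slope (A j))
      (fun i j v => (intercept (A j) - intercept (A i)) * (slope (A v) - slope (A j))
         < (intercept (A v) - intercept (A j)) * (slope (A j) - slope (A i))) l K1)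
      as [(s & S1 & S2 & S3)|(s & S1 & S2 & S3)].
    - intros x y Hx Hy Hxy; apply Rdichotomy, K4; auto.
    - lia.
    - exists (-1), s; split; [auto|]; split; [intros; apply S1; lia|];
        split; [intros; apply S2; lia|].
      intros i Hi; apply edge_slope_le; [apply S2; lia..|].
      assert (K := S3 i ltac:(lia)); lra.
    - exists 1, s; split; [auto|]; split; [intros; apply S1; lia|];
        split; [intros; apply S2; lia|].
      intros i Hi; apply edge_slope_le; [apply S2; lia..|].
      assert (K := S3 i ltac:(lia)); lra. }
  destruct Hweak as (eps & s & Heps & S1 & S2 & S3).
  assert (Hs : forall i, (i <= n)%nat -> (s i < N)%nat /\ ~ vertical (A (s i))).
  { intros i Hi; split; [apply L2, K2, S1; auto | apply H2, K2, S1; auto]. }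
  assert (Hch : concave_chain (k * c) (fun t => slope (A (s (t * S r)%nat)))
    (fun t => eps * intercept (A (s (t * S r)%nat)))).
  { apply (concave_chain_of_weak N n); auto. }
  assert (Hidx : forall t, (t < k * c)%nat -> (t * S r <= n)%nat) by (unfold n; intros; nia).
  exists (fun t => s (t * S r)%nat); split; [|split].
  - intros t Ht; apply Hs, Hidx; auto.
  - intros t u Htu E; assert (K := proj1 Hch t u Htu); simpl in K; rewrite E in K; lra.
  - intros x; apply (blocks_transversal A k c eps); auto.
    + lia.
    + intros t Ht; apply Hs, Hidx; auto.
Qed.
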